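(* (General Lift.) Fix a dimension $d$ and a geometric construction in $d$-dimensional space producing elements $q_1,\ldots,q_s$ from input elements $p_1,\ldots,p_N$, where each step is either the (stable) join of $d$ previously obtained points into a hyperplane or the (stable) intersection of $d$ previously obtained hyperplanes into a point, computed by Cramer's rule. Suppose this construction can be meaningfully performed in projective space over $\mathbb{K}$ by Cramer's rule, and suppose the construction of each $q_i$ is tropically admissible. Then for any specialization of the tropical input data, given by homogeneous coordinates $p_i=[p_i^1:\ldots:p_i^{m_i}]$ ($m_i=d+1$), $1\le i\le N$, there exists a nonempty set $U\subseteq(\mathbb{C}^* )^{m_1-1}\times\cdots\times(\mathbb{C}^* )^{m_N-1}$ (each factor viewed inside $\mathbb{P}^{m_i-1}(\mathbb{C})$ via homogeneous coordinates) such that: 1. for every $(x_1,\ldots,x_N)\in U$ there exist $P_1,\ldots,P_N$ with Puiseux series coordinates such that $T(P_i)=p_i$, $Pc(P_i)=x_i$, and the projective construction of $Q_1,\ldots,Q_s$ from $P_1,\ldots,P_N$ is meaningful; 2. for all $(P_1,\ldots,P_N)\in\mathbb{P}^{m_1-1}(\mathbb{K})\times\cdots\times\mathbb{P}^{m_N-1}(\mathbb{K})$ with $T(P_i)=p_i$ and $(Pc(P_1),\ldots,Pc(P_N))\in U$, the tropicalizations of the resulting elements $Q_1,\ldots,Q_s$ coincide with the tropical elements $q_1,\ldots,q_s$ obtained by the tropical construction using tropical determinants; in particular all such lifts yield the same tropical final elements.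
   Context: $\mathbb{K}$ is the field of Puiseux series with complex coefficients and real exponents; for $x\in\mathbb{K}^*$, $o(x)$ is its smallest exponent with nonzero coefficient, $T(x)=-o(x)$, and $Pc(x)$ is the coefficient of $t^{o(x)}$; for points/hyperplanes given by homogeneous coordinates, $T$ and $Pc$ are applied coordinatewise. $\mathbb{T}=(\mathbb{R},\max,+)$. Hyperplanes $\bigoplus_i a_i\odot x_i$ (tropical) or $\sum a_ix_i=0$ (classical) are identified with the point $[a_1:\dots:a_{d+1}]$ of the dual space. Tropical Cramer's rule: for an $n\times(n+1)$ tropical matrix $O$ (here $n=d$, rows being the homogeneous coordinates of the $d$ given points or hyperplanes), the output is $[\,|O^{1}|_t:\ldots:|O^{n+1}|_t\,]$, where $O^{i}$ is $O$ with column $i$ deleted and $|M|_t=\max_{\sigma}\sum_i m_{i\sigma(i)}$ is the tropical determinant; this gives the stable join of $d$ points / stable intersection of $d$ hyperplanes. The classical step uses classical Cramer's rule (signed maximal minors), and is meaningful when the resulting element is well defined. The construction graph of an element $P$ has as vertices all elements recursively used to construct $P$ (including $P$ and input elements), with an edge from each constructed element to each of the elements from which it is directly constructed. The construction of $P$ is tropically admissible if its construction graph is a tree. *)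

(* Defs.v *)
From HB Require Import structures.
From mathcomp Require Import all_boot all_order all_algebra all_fingroup.
From mathcomp Require Import complex.
From mathcomp Require Import boolp classical_sets cardinality fsbigop reals.
Export Order.TTheory GRing.Theory Num.Theory.

Set Implicit Arguments.
Unset Strict Implicit.
Unset Printing Implicit Defensive.

Local Open Scope ring_scope.
Local Open Scope classical_set_scope.

(* The field K of Puiseux series with complex coefficients and real         *)
(* exponents.  R : realType plays the role of the reals, R[i] of C.         *)
(* A series  sum_e a_e t^e  is represented by its coefficient function       *)
(* a : R -> R[i]; it belongs to K when its support is left-finite           *)
(* (only finitely many exponents below any bound), i.e. the support is      *)
(* either finite or has +oo as its only accumulation point.                  *)

Definition series (R : realType) := R -> R[i].

Definition is_puiseux (R : realType) (f : series R) : Prop :=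
  forall r : R, finite_set [set e | e <= r /\ f e != 0].

Definition sadd (R : realType) (f g : series R) : series R := fun e => f e + g e.
Definition sopp (R : realType) (f : series R) : series R := fun e => - f e.
Definition szero (R : realType) : series R := fun _ => 0.
Definition sone (R : realType) : series R := fun e => if e == 0 then 1 else 0.
(* Cauchy product: (fg)_e = sum_{a+b=e} f_a g_b (a finite sum on K). *)
Definition smul (R : realType) (f g : series R) : series R := fun e =>
  (\sum_(a \in [set a | f a != 0 /\ g (e - a) != 0]) (f a * g (e - a)))%R.

(* o(x): smallest exponent with nonzero coefficient; T(x) = - o(x);        *)
(* Pc(x): coefficient of t^{o(x)}.  Only used for x <> 0.                  *)
Definition ord_s (R : realType) (f : series R) : R := inf [set e | f e != 0].
Definition trop_s (R : realType) (f : series R) : R := - ord_s f.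
Definition Pc_s (R : realType) (f : series R) : R[i] := f (ord_s f).

Definition sdet (R : realType) (d : nat) (M : 'I_d -> 'I_d -> series R)
  : series R :=
  \big[@sadd R / @szero R]_(s : 'S_d)
     (let p := \big[@smul R / @sone R]_(r < d) M r (s r) in
      if odd_perm s then sopp p else p).

Definition cramer_K (R : realType) (d : nat) (O : 'I_d -> 'I_d.+1 -> series R)
  : 'I_d.+1 -> series R := fun i =>
  let m := sdet (fun r j => O r (lift i j)) in
  if odd i then sopp m else m.

(* tropical determinant |M|_t = max_sigma sum_r m_{r, sigma r}; the max is
   seeded with the identity term (which is one of the terms). *)
Definition tdet (R : realType) (d : nat) (M : 'I_d -> 'I_d -> R) : R :=
  \big[Num.max / (\sum_(r < d) M r r)]_(s : 'S_d) (\sum_(r < d) M r (s r)).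

Definition cramer_T (R : realType) (d : nat) (O : 'I_d -> 'I_d.+1 -> R)
  : 'I_d.+1 -> R := fun i => tdet (fun r j => O r (lift i j)).

(* Constructions.  Elements are indexed by 'I_(N + s): the first N are the  *)
(* inputs p_1..p_N, element N + k is the k-th constructed element q_k,      *)
(* obtained from the d elements  args k r  (r < d), all previously obtained *)
(* (args k r < N + k).                                                      *)

Definition elt (V : Type) (N s : nat) (p : 'I_N -> V) (q : 'I_s -> V)
  (j : 'I_(N + s)) : V :=
  match split j with inl i => p i | inr k => q k end.

Fixpoint eval_steps (V : Type) (d N s : nat) (cr : ('I_d -> V) -> V) (v0 : V)
  (args : 'I_s -> 'I_d -> 'I_(N + s)) (p : 'I_N -> V) (n : nat) : 'I_s -> V :=
  match n with
  | 0 => fun _ => v0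
  | n'.+1 =>
      let prev := eval_steps cr v0 args p n' in
      fun k => if val k == n' then cr (fun r => elt p prev (args k r))
               else prev k
  end.

Definition eval_con (V : Type) (d N s : nat) (cr : ('I_d -> V) -> V) (v0 : V)
  (args : 'I_s -> 'I_d -> 'I_(N + s)) (p : 'I_N -> V) : 'I_s -> V :=
  eval_steps cr v0 args p s.

Definition trop_con (R : realType) (d N s : nat)
  (args : 'I_s -> 'I_d -> 'I_(N + s)) (p : 'I_N -> 'I_d.+1 -> R)
  : 'I_s -> 'I_d.+1 -> R :=
  eval_con (@cramer_T R d) (fun _ => 0) args p.

Definition class_con (R : realType) (d N s : nat)
  (args : 'I_s -> 'I_d -> 'I_(N + s)) (P : 'I_N -> 'I_d.+1 -> series R)
  : 'I_s -> 'I_d.+1 -> series R :=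
  eval_con (@cramer_K R d) (fun _ => @szero R) args P.

Definition proj_pt_K (R : realType) (d : nat) (P : 'I_d.+1 -> series R) : Prop :=
  (forall j, is_puiseux (P j)) /\ exists j, P j <> @szero R.

Definition meaningful (R : realType) (d N s : nat)
  (args : 'I_s -> 'I_d -> 'I_(N + s)) (P : 'I_N -> 'I_d.+1 -> series R) : Prop :=
  forall k, exists j, class_con args P k j <> @szero R.

(* T(P) = p in tropical projective space (coordinatewise, up to a common
   additive constant; all coordinates of P nonzero) *)
Definition trop_eq (R : realType) (d : nat) (P : 'I_d.+1 -> series R)
  (p : 'I_d.+1 -> R) : Prop :=
  (forall j, P j <> @szero R) /\
  exists c : R, forall j, trop_s (P j) = p j + c.

(* Pc(P) = y in P^d(C) (coordinatewise, up to a nonzero scalar) *)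
Definition Pc_eq (R : realType) (d : nat) (P : 'I_d.+1 -> series R)
  (y : 'I_d.+1 -> R[i]) : Prop :=
  exists2 lam : R[i], lam != 0 & forall j, Pc_s (P j) = lam * y j.

(* (C^* )^d viewed inside P^d(C): x |-> [x_1 : ... : x_d : 1] *)
Definition hom_pt (R : realType) (d : nat) (x : 'I_d -> R[i]) : 'I_d.+1 -> R[i] :=
  fun j => match unlift ord_max j with Some j' => x j' | None => 1 end.

Definition child (d N s : nat) (args : 'I_s -> 'I_d -> 'I_(N + s))
  : rel 'I_(N + s) := fun u v =>
  match split u with inl _ => false | inr k => [exists r, args k r == v] end.

Definition cgraph_V (d N s : nat) (args : 'I_s -> 'I_d -> 'I_(N + s))
  (u : 'I_(N + s)) : {set 'I_(N + s)} :=
  [set v | connect (child args) u v].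

Definition cgraph_adj (d N s : nat) (args : 'I_s -> 'I_d -> 'I_(N + s))
  (u : 'I_(N + s)) : rel 'I_(N + s) := fun a b =>
  [&& a \in cgraph_V args u, b \in cgraph_V args u &
      child args a b || child args b a].

Definition is_tree (T : finType) (V : {set T}) (adj : rel T) : Prop :=
  (forall a b, a \in V -> b \in V -> connect adj a b) /\
  ~ (exists c : seq T, [/\ (3 <= size c)%N, all (mem V) c & ucycle adj c]).

Definition trop_admissible (d N s : nat) (args : 'I_s -> 'I_d -> 'I_(N + s))
  (k : 'I_s) : Prop :=
  is_tree (cgraph_V args (rshift N k)) (cgraph_adj args (rshift N k)).

(* Main.v *)
Require Import Defs.
From HB Require Import structures.
From mathcomp Require Import all_boot all_order all_algebra all_fingroup.
From mathcomp Require Import complex.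
From mathcomp Require Import boolp classical_sets cardinality fsbigop reals.
From mathcomp Require Import ring lra.
Import Order.TTheory GRing.Theory Num.Theory.

Set Implicit Arguments.
Unset Strict Implicit.
Unset Printing Implicit Defensive.

Local Open Scope ring_scope.
Local Open Scope classical_set_scope.

(* If each row of a matrix over K has lead terms with tropicalization T and
   principal coefficients a, then the coefficient of det at the order predicted
   by the tropical determinant is the sum of the signed products of the a's over
   the permutations attaining the tropical maximum.  Hence the tropical and the
   classical constructions agree as soon as these principal coefficients, which
   are polynomials in the principal coefficients x of the inputs, do not vanish,
   and U is the set of such x.

   U is nonempty because of the tree hypothesis: the arguments of every step
   depend on disjoint sets of inputs.  Substituting x_{i,c} = z^{(c+1)(d+1)^i}
   turns multidegrees into base-(d+1) expansions, and by induction every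
   coordinate of every element is a univariate polynomial in z whose dominant
   multidegree determines the coordinate; so the products occurring in a Cramer
   step have pairwise distinct degrees and cannot cancel.

   That the arguments of a step are pairwise distinct is not part of the tree
   hypothesis; it follows from the construction being meaningful over K, as a
   determinant with two equal rows vanishes. *)

(** * The ring of Puiseux series *)

Section PuiseuxRing.
Variable R : realType.
Implicit Types (f g h : series R) (v e r : R).

Definition vanish_below v f := forall e, e < v -> f e = 0.

Lemma vanish_below_ge v f e : vanish_below v f -> f e != 0 -> v <= e.
Proof. by move=> fv fe; rewrite leNgt; apply: contra fe => /fv->. Qed.

Lemma vanish_below_le v w f : v <= w -> vanish_below w f -> vanish_below v f.
Proof. by move=> vw fw e ev; apply: fw; exact: lt_le_trans vw. Qed.

Lemma seq_min (l : seq R) x : x \in l ->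
  exists2 m, m \in l & {in l, forall y, m <= y}.
Proof.
elim: l x => // a l IHl x _; case: l IHl => [_|b l /(_ b)].
  by exists a; [rewrite mem_head | move=> y; rewrite inE => /eqP->].
rewrite mem_head => /(_ isT)[m ml mmin]; exists (Num.min a m).
  by rewrite inE minElt; case: ifP; rewrite ?eqxx ?ml ?orbT.
move=> y; rewrite inE ge_min => /predU1P[->|/mmin->]; rewrite ?lexx//.
exact: orbT.
Qed.

Lemma puiseux_min f : is_puiseux f -> f <> @szero R ->
  exists2 v, f v != 0 & vanish_below v f.
Proof.
move=> pf f0; have [e fe] : exists e, f e != 0.
  apply: contrapT => /forallNP f_0; apply: f0; apply: funext => e.
  by apply/eqP; apply: contrapT => /negP/f_0.
have [l El] := (finite_seqP _).1 (pf e).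
have inl x : (x \in l) <-> x <= e /\ f x != 0.
  by have := congr1 (fun A : set R => A x) El => /= ->.
have [m /inl[me fm] mmin] := seq_min (proj2 (inl e) (conj (lexx e) fe)).
exists m => // x xm; apply: contraTeq xm => fx; rewrite -leNgt.
have [xe|/ltW ex] := leP x e; first exact: mmin (proj2 (inl x) (conj xe fx)).
exact: le_trans ex.
Qed.

Lemma puiseux_bound f : is_puiseux f -> exists v, vanish_below v f.
Proof.
move=> pf; case: (pselect (f = @szero R)) => [->|/(puiseux_min pf)[v]].
  by exists 0.
by exists v.
Qed.

Definition lsupp f r := [set e | e <= r /\ f e != 0].

(** Enlarging the index set only adds zero terms, so that several products can be summed over one
    common set. *)
Lemma smulE (A : set R) f g e :
  (forall a, f a != 0 -> g (e - a) != 0 -> A a) ->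
  smul f g e = \sum_(a \in A) f a * g (e - a).
Proof.
move=> fgA; apply: fsbig_widen => [a [fa ga]|a [_ /not_andP nfg]] /=.
  exact: fgA.
by apply/eqP; rewrite mulf_eq0 -(negbK (f a == 0)) -(negbK (g _ == 0)) -negb_and;
  apply/negP => /andP[fa ga]; case: nfg.
Qed.

Lemma smul_lsupp v r f g e : vanish_below v g -> e - v <= r ->
  smul f g e = \sum_(a \in lsupp f r) f a * g (e - a).
Proof.
move=> gv evr; apply: smulE => a fa /(vanish_below_ge gv); split=> //.
by apply: le_trans evr; lra.
Qed.

Lemma smul_neq0 f g e : smul f g e != 0 ->
  exists a, f a != 0 /\ g (e - a) != 0.
Proof.
move=> fge; apply: contrapT => /forallNP nfg; move/eqP: fge; apply.
by rewrite (@smulE set0) ?fsbig_set0// => a fa ga; apply: (nfg a).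
Qed.

Lemma puiseux_szero : is_puiseux (@szero R).
Proof.
move=> r; apply: (sub_finite_set _ (finite_set0 R)) => e [_ /eqP].
by case.
Qed.

Lemma puiseux_monomial (c : R[i]) v :
  is_puiseux (fun e : R => if e == v then c else 0).
Proof.
move=> r; apply: (sub_finite_set _ (finite_set1 v)) => e [_].
by have [->|_] := eqVneq e v => // /eqP.
Qed.

Lemma puiseux_sadd f g : is_puiseux f -> is_puiseux g -> is_puiseux (sadd f g).
Proof.
move=> pf pg r; have : finite_set (lsupp f r `|` lsupp g r).
  by rewrite finite_setU; split; [apply: pf | apply: pg].
apply: sub_finite_set => e [er fge].
have [f0|f0] := eqVneq (f e) 0; last by left.
by right; split=> //; move: fge; rewrite /sadd f0 add0r.
Qed.

Lemma puiseux_sopp f : is_puiseux f -> is_puiseux (sopp f).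
Proof.
move=> pf r; apply: sub_finite_set (pf r) => e [er].
by rewrite /sopp oppr_eq0.
Qed.

Lemma puiseux_smul f g : is_puiseux f -> is_puiseux g -> is_puiseux (smul f g).
Proof.
move=> pf pg r; have [v fv] := puiseux_bound pf.
have [w gw] := puiseux_bound pg.
apply: (sub_finite_set _ (finite_image (fun x => x.1 + x.2)
  (finite_setX (pf (r - w)) (pg (r - v))))).
move=> e [er /smul_neq0[a [fa ga]]]; exists (a, e - a); last by rewrite /=; ring.
have := vanish_below_ge fv fa; have := vanish_below_ge gw ga => wle vle.
by split; split=> //=; lra.
Qed.

Lemma smulC f g : smul f g = smul g f.
Proof.
apply: funext => e; rewrite /smul.
rewrite (@reindex_fsbig _ _ _ _ _ (fun a => e - a)
  [set a | g a != 0 /\ f (e - a) != 0]).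
  by rewrite /=; apply: eq_fsbigr => a _; rewrite mulrC subKr.
split=> [a [ga fa]|a b _ _ /(congr1 (fun x : R => e - x))|a [fa ga]] /=.
- by rewrite subKr.
- by rewrite !subKr.
by exists (e - a); rewrite /= subKr.
Qed.

(** Both sides are one double sum of [f a * g b * h (e - a - b)], taken in opposite orders; with
    [smulC] this gives associativity. *)
Lemma smulCA f g h : is_puiseux f -> is_puiseux g -> is_puiseux h ->
  smul f (smul g h) = smul g (smul f h).
Proof.
move=> pf pg ph; apply: funext => e.
have [u fu] := puiseux_bound pf; have [v gv] := puiseux_bound pg.
have [w hw] := puiseux_bound ph.
have vanish x y F G : vanish_below x F -> vanish_below y G ->
    vanish_below (x + y) (smul F G).
  move=> Fx Gy z; rewrite ltNge; apply: contraNeq => /smul_neq0[a [Fa Ga]].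
  by have := vanish_below_ge Fx Fa; have := vanish_below_ge Gy Ga; lra.
(* The range of [b] is enlarged to a finite set independent of [a], so that the two sums can be
   exchanged. *)
have expand x y F G : vanish_below x F -> vanish_below y G ->
    smul F (smul G h) e = \sum_(a \in lsupp F (e - (y + w)))
      \sum_(b \in lsupp G (e - (x + w))) F a * (G b * h (e - a - b)).
  move=> Fx Gy; rewrite (smul_lsupp _ (vanish _ _ _ _ Gy hw) (lexx _)).
  apply: eq_fsbigr => a /set_mem[_ /(vanish_below_ge Fx) xa].
  rewrite (smul_lsupp (r := e - (x + w)) _ hw); last by lra.
  by rewrite mulr_fsumr.
rewrite (expand _ _ _ _ fu gv) (expand _ _ _ _ gv fu).
rewrite exchange_fsbig; [|exact: pf|exact: pg].
apply: eq_fsbigr => b _; apply: eq_fsbigr => a _.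
by rewrite mulrCA addrAC.
Qed.

Lemma smul1 f : smul (@sone R) f = f.
Proof.
apply: funext => e; rewrite (@smulE [set 0]) ?fsbig_set1 /sone.
  by rewrite eqxx mul1r subr0.
by move=> a; have [->|_] := eqVneq a 0 => // /eqP.
Qed.

Lemma smulDr f g h : is_puiseux f -> is_puiseux g -> is_puiseux h ->
  smul f (sadd g h) = sadd (smul f g) (smul f h).
Proof.
move=> pf pg ph; apply: funext => e.
have [v gv] := puiseux_bound pg; have [w hw] := puiseux_bound ph.
have gm : vanish_below (Num.min v w) g.
  by apply: vanish_below_le gv; rewrite ge_min lexx.
have hm : vanish_below (Num.min v w) h.
  by apply: vanish_below_le hw; rewrite ge_min lexx orbT.
have ghm : vanish_below (Num.min v w) (sadd g h).
  by move=> x xm; rewrite /sadd gm ?hm ?addr0.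
rewrite /sadd (smul_lsupp _ ghm (lexx _)) (smul_lsupp _ gm (lexx _)).
rewrite (smul_lsupp _ hm (lexx _)).
rewrite -fsbig_split/=; last exact: pf.
by apply: eq_fsbigr => a _; rewrite -mulrDr.
Qed.

(** Bundling the support condition yields a commutative ring, which makes the general theory of
    determinants available for [sdet]. *)
Record puiseux := Puiseux { pval :> series R; pvalP : is_puiseux pval }.

Lemma pval_inj : injective pval.
Proof.
case=> [f pf] [g pg] /= fg; rewrite fg in pf *.
by congr Puiseux; apply: Prop_irrelevance.
Qed.

HB.instance Definition _ := gen_eqMixin puiseux.
HB.instance Definition _ := gen_choiceMixin puiseux.

Definition padd (f g : puiseux) := Puiseux (puiseux_sadd (pvalP f) (pvalP g)).
Definition popp (f : puiseux) := Puiseux (puiseux_sopp (pvalP f)).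
Definition pzero := Puiseux puiseux_szero.
Definition pmul (f g : puiseux) := Puiseux (puiseux_smul (pvalP f) (pvalP g)).
Definition pone := Puiseux (puiseux_monomial 1 0).

Lemma paddA : associative padd.
Proof. by move=> f g h; apply/pval_inj/funext => e; apply: addrA. Qed.
Lemma paddC : commutative padd.
Proof. by move=> f g; apply/pval_inj/funext => e; apply: addrC. Qed.
Lemma padd0 : left_id pzero padd.
Proof. by move=> f; apply/pval_inj/funext => e; apply: add0r. Qed.
Lemma paddN : left_inverse pzero popp padd.
Proof. by move=> f; apply/pval_inj/funext => e; apply: addNr. Qed.
HB.instance Definition _ := GRing.isZmodule.Build puiseux paddA paddC padd0 paddN.

Lemma pmulC : commutative pmul.
Proof. by move=> f g; apply/pval_inj/smulC. Qed.
Lemma pmulA : associative pmul.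
Proof.
move=> f g h; apply/pval_inj => /=.
by rewrite (smulC g) (smulC (smul f g)); apply: smulCA; apply: pvalP.
Qed.
Lemma pmul1 : left_id pone pmul.
Proof. by move=> f; apply/pval_inj/smul1. Qed.
Lemma pmulDl : left_distributive pmul padd.
Proof.
move=> f g h; apply/pval_inj => /=.
by rewrite !(smulC _ h) smulDr//; apply: pvalP.
Qed.
Lemma pone_neq0 : pone != pzero.
Proof.
apply/eqP => /(congr1 (fun f : puiseux => pval f 0))/eqP /=.
by rewrite eqxx; apply/negP/oner_neq0.
Qed.
HB.instance Definition _ :=
  GRing.Zmodule_isComNzRing.Build puiseux pmulA pmulC pmul1 pmulDl pone_neq0.

Lemma sdet_puiseux d (M : 'I_d -> 'I_d -> puiseux) :
  sdet (fun i j => pval (M i j)) = pval (\det (\matrix_(i, j) M i j)).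
Proof.
rewrite /sdet /determinant.
apply: (big_ind2 (fun (f : series R) (g : puiseux) => f = pval g)) => //.
  by move=> _ f _ g -> ->.
move=> s _; have -> : \big[@smul R/@sone R]_(i < d) pval (M i (s i)) =
    pval (\prod_i (\matrix_(i, j) M i j) i (s i)).
  apply: (big_ind2 (fun (f : series R) (g : puiseux) => f = pval g)) => //.
    by move=> _ f _ g -> ->.
  by move=> i _; rewrite mxE.
by case: odd_perm; rewrite ?mulN1r ?mul1r.
Qed.

Lemma sdet_alternate d (M : 'I_d -> 'I_d -> series R) i1 i2 :
  (forall i j, is_puiseux (M i j)) -> i1 != i2 -> M i1 =1 M i2 ->
  sdet M = @szero R.
Proof.
move=> pM i12 eqM; pose M' i j := Puiseux (pM i j).
rewrite -[M]/(fun i j => pval (M' i j)) sdet_puiseux.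
rewrite (determinant_alternate i12)// => j; rewrite !mxE.
by apply: pval_inj; apply: eqM.
Qed.

Lemma puiseux_sdet d (M : 'I_d -> 'I_d -> series R) :
  (forall i j, is_puiseux (M i j)) -> is_puiseux (sdet M).
Proof.
move=> pM; pose M' i j := Puiseux (pM i j).
by rewrite -[M]/(fun i j => pval (M' i j)) sdet_puiseux; apply: pvalP.
Qed.

End PuiseuxRing.

(** * Leading terms and orders *)

Section Lead.
Variable R : realType.
Implicit Types (f g : series R) (v w : R) (a b : R[i]).

(* f = a t^v + higher order terms, where a = 0 is allowed. *)
Definition lead f v a := vanish_below v f /\ f v = a.

Lemma lead_weaken f v a w : lead f v a -> w < v -> lead f w 0.
Proof.
by case=> fv _ wv; split; [apply: vanish_below_le fv; exact: ltW | exact: fv].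
Qed.

Lemma lead0 v : lead (@szero R) v 0.
Proof. by []. Qed.

Lemma lead_monomial v a : lead (fun e : R => if e == v then a else 0) v a.
Proof. by split=> [e ev|]; rewrite ?eqxx// lt_eqF. Qed.

Lemma leadD f g v a b : lead f v a -> lead g v b -> lead (sadd f g) v (a + b).
Proof.
move=> [fv <-] [gv <-]; split=> // e ev.
by rewrite /sadd fv// gv// addr0.
Qed.

Lemma leadN f v a : lead f v a -> lead (sopp f) v (- a).
Proof. by move=> [fv <-]; split=> // e ev; rewrite /sopp fv// oppr0. Qed.

Lemma leadM f g v w a b :
  lead f v a -> lead g w b -> lead (smul f g) (v + w) (a * b).
Proof.
move=> [fv <-] [gw <-]; split=> [e|].
  rewrite ltNge; apply: contraNeq => /smul_neq0[x [fx gx]].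
  by have := vanish_below_ge fv fx; have := vanish_below_ge gw gx; lra.
rewrite (@smulE _ [set v]) ?fsbig_set1; first by rewrite addrAC subrr add0r.
move=> x fx gx /=; apply/eqP.
by have := vanish_below_ge fv fx; have := vanish_below_ge gw gx; lra.
Qed.

Lemma lead_prod d (f : 'I_d -> series R) (v : 'I_d -> R) (a : 'I_d -> R[i]) :
  (forall r, lead (f r) (v r) (a r)) ->
  lead (\big[@smul R/@sone R]_(r < d) f r) (\sum_r v r) (\prod_r a r).
Proof.
move=> fva; apply: (big_ind3 (fun f v a => lead f v a)) => //.
  exact: lead_monomial.
by move=> *; apply: leadM.
Qed.

Lemma lead_neq0 f v a : lead f v a -> a != 0 -> f <> @szero R.
Proof. by move=> [_ <-] fv f0; move: fv; rewrite f0 => /eqP. Qed.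

Lemma lead_ord f v a : lead f v a -> a != 0 -> ord_s f = v.
Proof.
move=> [fv <-] fv0; apply/eqP; rewrite eq_le; apply/andP; split.
  by apply: ge_inf => //; exists v => e; apply: vanish_below_ge.
by apply: lb_le_inf; [exists v | move=> e; apply: vanish_below_ge].
Qed.

Lemma lead_Pc f v a : lead f v a -> a != 0 -> Pc_s f = a.
Proof. by move=> fva a0; rewrite /Pc_s (lead_ord fva a0) fva.2. Qed.

Lemma puiseux_lead f : is_puiseux f -> f <> @szero R ->
  lead f (ord_s f) (Pc_s f).
Proof.
move=> pf /(puiseux_min pf)[v fv0 fv].
have /lead_ord/(_ fv0) fvE : lead f v (f v) by [].
by rewrite /Pc_s fvE.
Qed.

End Lead.

(** * Leading terms under Cramer's rule *)

Section Cramer.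
Variables (R : realType) (d : nat).

Lemma tdet_ge (M : 'I_d -> 'I_d -> R) (s : 'S_d) :
  \sum_r M r (s r) <= tdet M.
Proof. exact: (le_bigmax _ (fun s : 'S_d => \sum_r M r (s r))). Qed.

Lemma tdet_attained (M : 'I_d -> 'I_d -> R) :
  exists s : 'S_d, \sum_r M r (s r) = tdet M.
Proof.
apply: (big_ind (fun x => exists s : 'S_d, \sum_r M r (s r) = x)).
- by exists 1%g; apply: eq_bigr => r _; rewrite perm1.
- by move=> x y xP yP; rewrite maxElt; case: ifP.
by move=> s _; exists s.
Qed.

(* Cramer's rule on principal coefficients: only the permutations attaining
   the tropical determinant contribute to the term of lowest order. *)
Definition pc_cramer (A : comNzRingType) (t : 'I_d -> 'I_d.+1 -> R)
    (a : 'I_d -> 'I_d.+1 -> A) : 'I_d.+1 -> A := fun j =>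
  (-1) ^+ j * \sum_(s : 'S_d | \sum_r t r (lift j (s r)) == cramer_T t j)
                (-1) ^+ s * \prod_r a r (lift j (s r)).

(** A permutation takes exactly one entry from every row, so the shifts [c r] and scalars [lam r],
    which express the ambiguity of homogeneous coordinates, factor out of all terms alike. *)
Lemma lead_cramer (O : 'I_d -> 'I_d.+1 -> series R) t a c lam :
  (forall r j, lead (O r j) (- (t r j + c r)) (lam r * a r j)) ->
  forall j, lead (cramer_K O j) (- (cramer_T t j + \sum_r c r))
                 ((\prod_r lam r) * pc_cramer t a j).
Proof.
move=> Olead j; set v := - _.
suff: lead (sdet (fun r i => O r (lift j i))) v ((\prod_r lam r) *
    \sum_(s : 'S_d | \sum_r t r (lift j (s r)) == cramer_T t j)
                (-1) ^+ s * \prod_r a r (lift j (s r))).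
  rewrite /cramer_K /pc_cramer -signr_odd => ?; case: (odd j) => /=.
    by rewrite mulN1r mulrN; apply: leadN.
  by rewrite mul1r.
rewrite mulr_sumr big_mkcond.
apply: (big_ind2 (fun f b => lead f v b)) => [|f1 b1 f2 b2|s _].
- exact: lead0.
- exact: leadD.
have : lead (\big[@smul R/@sone R]_(r < d) O r (lift j (s r)))
    (- (\sum_r t r (lift j (s r)) + \sum_r c r))
    ((\prod_r lam r) * \prod_r a r (lift j (s r))).
  rewrite -big_split -big_split -sumrN; apply: lead_prod => r; exact: Olead.
have := tdet_ge (fun r i => t r (lift j i)) s; rewrite -/(cramer_T t j).
set q := \big[_/_]_(_ < d) _.
have [tE _ ql|tN tle ql] := eqVneq; last first.
  (* A term missing the tropical maximum starts strictly above [v] and contributes zero there. *)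
  have vlt : v < - (\sum_r t r (lift j (s r)) + \sum_r c r).
    by rewrite ltrN2 ltrD2r lt_neqAle tN.
  have := lead_weaken ql vlt; case: odd_perm => // /leadN.
  by rewrite oppr0.
move: ql; rewrite tE -/v; case: odd_perm => ql.
  by rewrite mulN1r mulrN; apply: leadN.
by rewrite mul1r.
Qed.

End Cramer.

(** * Recursion along a construction, and the tree hypothesis *)

Section Construction.
Variables (d N s : nat) (args : 'I_s -> 'I_d -> 'I_(N + s)).
Hypothesis args_lt : forall k r, (args k r < N + k)%N.

Lemma elt_lshift V (p : 'I_N -> V) (q : 'I_s -> V) i : elt p q (lshift s i) = p i.
Proof. by rewrite /elt -[lshift s i]/(unsplit (inl i)) unsplitK. Qed.

Lemma elt_rshift V (p : 'I_N -> V) (q : 'I_s -> V) k : elt p q (rshift N k) = q k.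
Proof. by rewrite /elt -[rshift N k]/(unsplit (inr k)) unsplitK. Qed.

Lemma elt_ind (Q : 'I_(N + s) -> Prop) :
  (forall i, Q (lshift s i)) ->
  (forall k, (forall r, Q (args k r)) -> Q (rshift N k)) -> forall u, Q u.
Proof.
move=> Ql Qr u; have [n] := ubnP u; elim: n u => // n IHn u un.
rewrite -[u]splitK; case: splitP => [i|k] uE /=; first exact: Ql.
apply: Qr => r; apply: IHn; rewrite ltnS in un.
by apply: leq_trans un; rewrite uE.
Qed.

Lemma eval_steps_stable V cr (v0 : V) (p : 'I_N -> V) n (k : 'I_s) :
  (k < n)%N -> eval_steps cr v0 args p n k = eval_steps cr v0 args p k.+1 k.
Proof.
elim: n => // n IHn; rewrite ltnS leq_eqVlt => /predU1P[-> //|kn].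
by rewrite [LHS]/= ltn_eqF// IHn.
Qed.

(** Step [k] reads only inputs and elements computed earlier, which later passes no longer
    change. *)
Lemma eval_conE V cr (v0 : V) (p : 'I_N -> V) k :
  eval_con cr v0 args p k =
  cr (fun r => elt p (eval_con cr v0 args p) (args k r)).
Proof.
rewrite /eval_con eval_steps_stable//= eqxx; congr cr; apply: funext => r.
rewrite -[args k r]splitK; case: splitP => [i|l] lE /=.
  by rewrite !elt_lshift.
have lk : (l < k)%N by have := args_lt k r; rewrite lE ltn_add2l.
by rewrite !elt_rshift eval_steps_stable// [RHS]eval_steps_stable.
Qed.

Lemma puiseux_elt (R : realType) (P : 'I_N -> 'I_d.+1 -> series R) :
  (forall i, proj_pt_K (P i)) ->
  forall u j, is_puiseux (elt P (class_con args P) u j).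
Proof.
move=> pP; apply: elt_ind => [i|k IHk] j; first by rewrite elt_lshift; case: (pP i).
rewrite elt_rshift /class_con eval_conE /cramer_K.
have pd := puiseux_sdet (fun r i => IHk r (lift j i)).
by case: odd => //; apply: puiseux_sopp.
Qed.

Lemma meaningful_args_inj (R : realType) (P : 'I_N -> 'I_d.+1 -> series R) k :
  (forall i, proj_pt_K (P i)) -> meaningful args P -> injective (args k).
Proof.
move=> pP /(_ k)[j] mP r r' argsE; apply: contra_notP mP => /eqP rr'.
rewrite /class_con eval_conE /cramer_K (sdet_alternate _ rr').
- by case: odd => //; apply: funext => e; apply: oppr0.
- by move=> i l; apply: puiseux_elt.
by move=> l; rewrite argsE.
Qed.

Lemma child_rshift k v : child args (rshift N k) v = [exists r, args k r == v].
Proof. by rewrite /child -[rshift N k]/(unsplit (inr k)) unsplitK. Qed.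

Lemma child_args k r : child args (rshift N k) (args k r).
Proof. by rewrite child_rshift; apply/existsP; exists r. Qed.

Lemma child_lt u v : child args u v -> (v < u)%N.
Proof.
rewrite /child; case: splitP => // k -> /existsP[r /eqP <-]; exact: args_lt.
Qed.

(* A vertex below two different arguments of k would close a cycle through k:
   k itself is not below its arguments, so the two descending paths yield an
   undirected path between the arguments that avoids k. *)
Lemma tree_args_disjoint k r r' w : trop_admissible args k ->
  args k r != args k r' ->
  connect (child args) (args k r) w -> ~~ connect (child args) (args k r') w.
Proof.
case=> _ acyclic neq_args rw; apply/negP => r'w; apply: acyclic.
set u := rshift N k; set adj := cgraph_adj args u.
pose adj' := [rel x y | [&& adj x y, x != u & y != u]].
have adjC : symmetric adj.
  by move=> x y; rewrite /adj /cgraph_adj andbCA orbC.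
have sym_adj' : connect_sym adj'.
  apply: sym_connect_sym => x y /=.
  by rewrite adjC; congr (_ && _); rewrite andbC.
have inV q : args k q \in cgraph_V args u.
  by rewrite inE; apply/connect1/child_args.
have descend q : connect (child args) (args k q) w -> connect adj' (args k q) w.
  case/connectP=> p; have : (args k q < u)%N by exact: args_lt.
  move: (inV q); elim: p (args k q) => [|y p IHp] x xV xu /=.
    by move=> _ ->.
  case/andP=> xy yp wE; have yu : (y < u)%N := ltn_trans (child_lt xy) xu.
  have yV : y \in cgraph_V args u.
    by move: xV; rewrite !inE => /connect_trans; apply; apply: connect1.
  apply: (connect_trans _ (IHp _ yV yu yp wE)); apply: connect1.
  rewrite /= /adj /cgraph_adj xV yV xy /=.
  by rewrite -!(inj_eq val_inj) !ltn_eqF.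
have /connectP[p0] : connect adj' (args k r) (args k r').
  by apply: (connect_trans (descend _ rw)); rewrite sym_adj'; apply: descend.
case/shortenP=> p adjp uniqp _ lastp.
have [p_adj p_u p_V] : [/\ path adj (args k r) p, u \notin p &
    all (mem (cgraph_V args u)) p].
  elim: p (args k r) adjp {uniqp lastp} => //= y p IHp x.
  case/andP=> /and3P[xy xu yu] /IHp[yp up Vp]; split.
  - by rewrite xy.
  - by rewrite inE negb_or eq_sym yu.
  by rewrite Vp andbT; case/and3P: xy.
have uV : u \in cgraph_V args u by rewrite inE connect0.
have u_args q : u != args k q.
  by rewrite -(inj_eq val_inj) eq_sym ltn_eqF//; apply: args_lt.
have adj_args q : adj u (args k q).
  by rewrite /adj /cgraph_adj uV inV child_args.
exists [:: u, args k r & p]; split.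
(* Distinct arguments force [p] to be nonempty, which gives the third vertex. *)
- by case: p lastp {adjp uniqp p_adj p_u p_V} => //= E; rewrite E eqxx in neq_args.
- by rewrite /= uV inV.
apply/andP; split.
  by rewrite /= adj_args rcons_path p_adj -lastp adjC adj_args.
by rewrite cons_uniq uniqp inE negb_or u_args p_u.
Qed.

End Construction.

(** * Degrees after the one-variable substitution *)

Section Degree.

(** The lowest digit is the remainder modulo [B]; removing it and dividing by [B] leaves a shorter
    expansion. *)
Lemma digits_inj B n (f g : 'I_n -> nat) :
  (forall i, (f i < B)%N) -> (forall i, (g i < B)%N) ->
  (\sum_i f i * B ^ i = \sum_i g i * B ^ i)%N -> f =1 g.
Proof.
elim: n f g => [|n IHn] f g fB gB; first by move=> _ [].
have horner (h : 'I_n.+1 -> nat) : (\sum_i h i * B ^ i =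
    (\sum_(i < n) h (lift ord0 i) * B ^ i) * B + h ord0)%N.
  rewrite big_ord_recl expn0 muln1 addnC big_distrl /=; congr addn.
  by apply: eq_bigr => i _; rewrite -mulnA -expnSr.
rewrite !horner => fgE.
have E0 : f ord0 = g ord0.
  by have := congr1 (modn^~ B) fgE; rewrite !modnMDl !modn_small.
have B0 : (0 < B)%N by apply: leq_ltn_trans (fB ord0).
move: fgE; rewrite E0 => /addIn/eqP; rewrite eqn_pmul2r// => /eqP/IHn E i.
by case: (unliftP ord0 i) => [j|] ->//; apply: E.
Qed.

(** The largest summand is strictly larger than each of the others, so its leading term survives;
    [i0] ensures that there is a summand. *)
Lemma size_sum_neq (A : nzRingType) (I : finType) (P : pred I)
    (F : I -> {poly A}) i0 :
  P i0 -> (forall i, P i -> F i != 0) ->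
  (forall i j, P i -> P j -> size (F i) = size (F j) -> i = j) ->
  exists2 i, P i & size (\sum_(i | P i) F i) = size (F i).
Proof.
move=> Pi0 F0 Finj; case: (arg_maxnP (fun i => size (F i)) Pi0) => m Pm mmax.
exists m => //; rewrite (bigD1 m)//= size_polyDl//.
apply: (big_ind (fun q : {poly A} => (size q < size (F m))%N)).
- by rewrite size_poly0 size_poly_gt0 F0.
- move=> p q pm qm; apply: leq_ltn_trans (size_polyD p q) _.
  by rewrite gtn_max pm.
move=> i /andP[Pi im]; rewrite ltn_neqAle [X in _ && X](mmax i Pi) andbT.
by apply: contra im => /eqP /Finj->.
Qed.

(** Writing sizes as successors makes the factors nonzero and turns size into degree, which is
    additive over a domain. *)
Lemma size_prodS (A : idomainType) d (F : 'I_d -> {poly A}) (n : 'I_d -> nat) :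
  (forall r, size (F r) = (n r).+1) ->
  size (\prod_r F r) = (\sum_r n r).+1.
Proof.
move=> Fn; apply: (big_ind2 (fun (q : {poly A}) m => size q = m.+1)) => //.
  by rewrite size_poly1.
move=> p m q k pm qk; rewrite size_mul -?size_poly_gt0 ?pm ?qk//.
by rewrite addnS.
Qed.

Variables (R : realType) (d N s : nat) (args : 'I_s -> 'I_d -> 'I_(N + s)).
Hypothesis args_inj : forall k, injective (args k).
Hypothesis args_lt : forall k r, (args k r < N + k)%N.
Hypothesis args_tree : forall k, trop_admissible args k.

Variable (A : idomainType) (t : 'I_(N + s) -> 'I_d.+1 -> R).
Variable (F : 'I_(N + s) -> 'I_d.+1 -> {poly A}).

(** The last coordinate gets digit 0 because [hom_pt] normalizes it to 1; the others get 1 to [d],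
    all of them digits in base [d.+1]. *)
Definition digit (c : 'I_d.+1) : nat :=
  if unlift ord_max c is Some c' then c'.+1 else 0.

Lemma digit_le c : (digit c <= d)%N.
Proof. by rewrite /digit; case: unliftP => // c' _; apply: ltn_ord. Qed.

Lemma digit_inj : injective digit.
Proof.
move=> c c'; rewrite /digit; case: unliftP => [j|] ->; case: unliftP => [j'|] -> //.
by move=> [] /val_inj->.
Qed.

Hypothesis F_input : forall i c, F (lshift s i) c = 'X^(digit c * d.+1 ^ i).
Hypothesis F_step : forall k, F (rshift N k) =
  pc_cramer (fun r => t (args k r)) (fun r => F (args k r)).

(* f c is the multidegree, in the inputs below u, of a dominant monomial of
   F u c; injectivity in c rules out cancellation in the next Cramer step. *)
Definition dominant u (f : 'I_d.+1 -> 'I_N -> nat) :=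
  [/\ forall c i, f c i != 0 -> connect (child args) u (lshift s i),
      forall c i, (f c i <= d)%N,
      forall c c', f c =1 f c' -> c = c' &
      forall c, size (F u c) = (\sum_i f c i * d.+1 ^ i)%N.+1].

Lemma dominant_exists u : exists f, dominant u f.
Proof.
elim/(elt_ind args_lt): u => [i|k /choice[f fP]].
  exists (fun c j => if j == i then digit c else 0%N); split.
  - by move=> c j; case: (eqVneq j i) => // ->; rewrite connect0.
  - by move=> c j; case: ifP => // _; apply: digit_le.
  - by move=> c c' /(_ i); rewrite eqxx => /digit_inj.
  move=> c; rewrite F_input size_polyXn (bigD1 i)//= eqxx big1 ?addn0// => j.
  by move/negPf->.
have fconn r : forall c i, f r c i != 0 -> connect (child args) (args k r) (lshift s i).
  by case: (fP r).
have fle r : forall c i, (f r c i <= d)%N by case: (fP r).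
have finj r : forall c c', f r c =1 f r c' -> c = c' by case: (fP r).
have fsize r c : size (F (args k r) c) = (\sum_i f r c i * d.+1 ^ i)%N.+1.
  by case: (fP r).
(* This is the multidegree of the product taking column [c r] in row [r]. Each input lies below at
   most one argument, so at most one summand is nonzero and no carry occurs. *)
pose g (c : 'I_d -> 'I_d.+1) i := (\sum_r f r (c r) i)%N.
have gE c r i : connect (child args) (args k r) (lshift s i) ->
    g c i = f r (c r) i.
  move=> ri; rewrite /g (bigD1 r)//= big1 ?addn0// => r' r'r.
  apply/eqP; apply: contraT => /fconn; apply: contraTT => _.
  apply: (tree_args_disjoint args_lt _ _ ri) => //.
  by rewrite (inj_eq (@args_inj k)) eq_sym.
have g_neq0 c i : g c i != 0 ->
    exists r, connect (child args) (args k r) (lshift s i).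
  rewrite /g sum_nat_eq0 negb_forall => /existsP[r /= /fconn]; by exists r.
have gle c i : (g c i < d.+1)%N.
  have [->//|/g_neq0[r ri]] := eqVneq (g c i) 0%N.
  by rewrite (gE c r)// ltnS.
(* The digits at inputs below [args k r] recover [f r (c r)], whose other digits are zero. *)
have ginj c c' : g c =1 g c' -> c =1 c'.
  move=> gg r; apply: (finj r) => i.
  have [ri|nri] := boolP (connect (child args) (args k r) (lshift s i)).
    by rewrite -!gE.
  have f0 b : f r b i = 0%N by apply/eqP; apply: contraNT nri => /fconn.
  by rewrite !f0.
pose term (j : 'I_d.+1) (v : 'S_d) : {poly A} :=
  (-1) ^+ v * \prod_r F (args k r) (lift j (v r)).
have size_term j v :
    size (term j v) = (\sum_i g (fun r => lift j (v r)) i * d.+1 ^ i)%N.+1.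
  rewrite size_Msign (size_prodS (fun r => fsize r _)) exchange_big.
  by congr S; apply: eq_bigr => i _; rewrite big_distrl.
have step (j : 'I_d.+1) : exists v : 'S_d, size (F (rshift N k) j) = size (term j v).
  (* Some permutation attains the tropical maximum, so the sum in [pc_cramer] is nonempty. *)
  have [v0 /eqP v0P] := tdet_attained (fun r i => t (args k r) (lift j i)).
  have [] := @size_sum_neq _ _ (fun v : 'S_d =>
    \sum_r t (args k r) (lift j (v r)) == cramer_T (fun r => t (args k r)) j)
    (term j) v0 v0P.
  - by move=> v _; rewrite -size_poly_gt0 size_term.
  - move=> v v' _ _; rewrite !size_term => -[] /digits_inj-/(_ _ _)/ginj vv'.
    apply/permP => r; apply: (@lift_inj _ j); exact: vv'.
  by move=> v _ vE; exists v; rewrite F_step /pc_cramer size_Msign.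
have [v vE] := choice step.
exists (fun j : 'I_d.+1 => g (fun r => lift j (v j r))); split => //.
- move=> j i /g_neq0[r]; apply: connect_trans.
  by apply/connect1/child_args.
- by move=> j i; rewrite -ltnS.
(* For [j] different from [j'], the minor without column [j] uses column [j'] in some row, whereas
   the minor without column [j'] never does. *)
- move=> j j' /ginj vv'; apply/eqP; apply: contraT => jj'.
  have [h hE] := unlift_some jj'; have := vv' ((v j)^-1 h)%g.
  by rewrite permKV -hE => /eqP; rewrite (negPf (neq_lift _ _)).
by move=> j; rewrite vE size_term.
Qed.

Lemma F_neq0 u c : F u c != 0.
Proof.
have [f [_ _ _ fE]] := dominant_exists u.
by rewrite -size_poly_gt0 fE.
Qed.

End Degree.

(** * Principal coefficients along the construction *)

Section PrincipalCoefficients.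
Variables (R : realType) (d N s : nat) (args : 'I_s -> 'I_d -> 'I_(N + s)).
Hypothesis args_lt : forall k r, (args k r < N + k)%N.
Variable p : 'I_N -> 'I_d.+1 -> R.

Definition pc_step (A : comNzRingType)
    (rows : 'I_d -> ('I_d.+1 -> R) * ('I_d.+1 -> A)) :=
  (cramer_T (fun r => (rows r).1),
   pc_cramer (fun r => (rows r).1) (fun r => (rows r).2)).

(* The tropical construction run together with its principal coefficients;
   the latter need the former to know which permutations are maximal. *)
Definition pc_elt (A : comNzRingType) (x : 'I_N -> 'I_d.+1 -> A) :=
  elt (fun i => (p i, x i))
    (eval_con (@pc_step A) (fun=> 0, fun=> 0) args (fun i => (p i, x i))).

Lemma pc_elt_input (A : comNzRingType) (x : 'I_N -> 'I_d.+1 -> A) i :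
  pc_elt x (lshift s i) = (p i, x i).
Proof. exact: elt_lshift. Qed.

Lemma pc_elt_step (A : comNzRingType) (x : 'I_N -> 'I_d.+1 -> A) k :
  pc_elt x (rshift N k) = pc_step (fun r => pc_elt x (args k r)).
Proof. by rewrite /pc_elt elt_rshift eval_conE. Qed.

Lemma pc_elt_trop (A : comNzRingType) (x : 'I_N -> 'I_d.+1 -> A) u :
  (pc_elt x u).1 = elt p (trop_con args p) u.
Proof.
elim/(elt_ind args_lt): u => [i|k IHk].
  by rewrite pc_elt_input elt_lshift.
rewrite pc_elt_step elt_rshift /trop_con eval_conE//=.
by congr cramer_T; apply: funext => r; apply: IHk.
Qed.

(** Meant for evaluating polynomials at a point; by [pc_elt_trop] both sides sum over the same
    maximal permutations. *)
Lemma pc_elt_rmorph (A B : comNzRingType) (phi : {rmorphism A -> B})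
    (x : 'I_N -> 'I_d.+1 -> A) u c :
  (pc_elt (fun i c => phi (x i c)) u).2 c = phi ((pc_elt x u).2 c).
Proof.
elim/(elt_ind args_lt): u c => [i|k IHk] c; first by rewrite !pc_elt_input.
rewrite !pc_elt_step /= /pc_cramer rmorphM rmorph_sign rmorph_sum; congr (_ * _).
have E r : (pc_elt (fun i c => phi (x i c)) (args k r)).1 =
    (pc_elt x (args k r)).1 by rewrite !pc_elt_trop.
apply: eq_big => v.
  rewrite (funext E); congr (_ == _).
  by apply: eq_bigr => r _; rewrite E.
move=> _; rewrite rmorphM rmorph_sign rmorph_prod; congr (_ * _).
by apply: eq_bigr => r _; apply: IHk.
Qed.

Lemma pc_elt_neq0 (A : idomainType) (k : 'I_s) (c : 'I_d.+1) :
  (forall k, injective (args k)) -> (forall k, trop_admissible args k) ->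
  (pc_elt (fun i c => 'X^(digit c * d.+1 ^ i) : {poly A}) (rshift N k)).2 c != 0.
Proof.
move=> inj tree; set x := fun _ _ => _.
apply: (F_neq0 inj args_lt tree (t := fun u => (pc_elt x u).1)
  (F := fun u => (pc_elt x u).2)) => [i b|l]; first by rewrite pc_elt_input.
by rewrite pc_elt_step.
Qed.

(** The shift [c] and the scalar [lam] are carried along because the inputs match [p] and [y] only
    up to these. The coefficient may still vanish here; membership in [U] will exclude that. *)
Lemma lead_elt (P : 'I_N -> 'I_d.+1 -> series R) (y : 'I_N -> 'I_d.+1 -> R[i]) :
  (forall i, proj_pt_K (P i)) -> (forall i, trop_eq (P i) (p i)) ->
  (forall i, Pc_eq (P i) (y i)) ->
  forall u, exists c, exists2 lam, lam != 0 &
    forall j, lead (elt P (class_con args P) u j)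
      (- (elt p (trop_con args p) u j + c)) (lam * (pc_elt y u).2 j).
Proof.
move=> pP Pp Py; apply: (elt_ind args_lt) => [i|k IHk].
  have [P0 [c ordP]] := Pp i; have [lam lam0 PcP] := Py i.
  exists c, lam => // j; rewrite !elt_lshift pc_elt_input -PcP -ordP opprK.
  by apply: puiseux_lead => //; case: (pP i).
have [c cP] := choice IHk.
have /choice[lam lamP] r : exists lam : R[i], lam != 0 /\
    forall j, lead (elt P (class_con args P) (args k r) j)
      (- (elt p (trop_con args p) (args k r) j + c r))
      (lam * (pc_elt y (args k r)).2 j).
  by case: (cP r) => lam; exists lam.
exists (\sum_r c r), (\prod_r lam r) => [|j].
  by apply/prodf_neq0 => r _; case: (lamP r).
rewrite !elt_rshift /class_con /trop_con !eval_conE// pc_elt_step /=.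
rewrite (funext (fun r => pc_elt_trop y (args k r))).
apply: lead_cramer => r i; exact: (lamP r).2.
Qed.

End PrincipalCoefficients.

(** * The set [U] and the explicit lifts *)

Theorem theorem2p12 (R : realType) (d N s : nat)
  (kind : 'I_(N + s) -> bool) (* true = point, false = hyperplane *)
  (args : 'I_s -> 'I_d -> 'I_(N + s)) :
  (0 < d)%N ->
  (* each step uses d previously obtained elements *)
  (forall k r, (args k r < N + k)%N) ->
  (* join of d points into a hyperplane / intersection of d hyperplanes *)
  (forall k r, kind (args k r) = ~~ kind (rshift N k)) ->
  (* the construction can be meaningfully performed over K *)
  (exists P : 'I_N -> 'I_d.+1 -> series R,
      (forall i, proj_pt_K (P i)) /\ meaningful args P) ->
  (* the construction of each q_k is tropically admissible *)
  (forall k, trop_admissible args k) ->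
  forall p : 'I_N -> 'I_d.+1 -> R,
  exists U : set ('I_N -> 'I_d -> R[i]),
    [/\ U !=set0,
        (forall x, U x -> forall i j, x i j != 0),
        (forall x, U x ->
           exists P : 'I_N -> 'I_d.+1 -> series R,
             [/\ forall i, proj_pt_K (P i),
                 forall i, trop_eq (P i) (p i),
                 forall i, Pc_eq (P i) (hom_pt (x i)) &
                 meaningful args P]) &
        (forall P : 'I_N -> 'I_d.+1 -> series R,
           (forall i, proj_pt_K (P i)) ->
           (forall i, trop_eq (P i) (p i)) ->
           (exists2 x, U x & forall i, Pc_eq (P i) (hom_pt (x i))) ->
           forall k, trop_eq (class_con args P k) (trop_con args p k))].
Proof.
move=> _ args_lt _ [P0 [pP0 mP0]] tree p.
have inj k : injective (args k) :=
  @meaningful_args_inj _ _ _ _ args_lt _ _ k pP0 mP0.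
pose pc (x : 'I_N -> 'I_d -> R[i]) := pc_elt args p (fun i => hom_pt (x i)).
pose U := [set x | (forall i j, x i j != 0) /\
  forall k j, (pc x (rshift N k)).2 j != 0].
(* Proved first because it serves twice: for arbitrary lifts, and to show that the explicit lift
   below is meaningful. *)
have tropU P : (forall i, proj_pt_K (P i)) -> (forall i, trop_eq (P i) (p i)) ->
    (exists2 x, U x & forall i, Pc_eq (P i) (hom_pt (x i))) ->
    forall k, trop_eq (class_con args P k) (trop_con args p k).
  move=> pP Pp [x [_ pcx] Px] k.
  have [c [lam lam0 leadk]] := lead_elt args_lt pP Pp Px (rshift N k).
  rewrite !elt_rshift in leadk; have pc0 j := mulf_neq0 lam0 (pcx k j).
  split=> [j|]; first exact: lead_neq0 (leadk j) (pc0 j).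
  by exists c => j; rewrite /trop_s (lead_ord (leadk j) (pc0 j)) opprK.
exists U; split => // [|x []//|x Ux].
  pose X (i : 'I_N) (c : 'I_d.+1) : {poly R[i]} := 'X^(digit c * d.+1 ^ i).
  (* The factor ['X] makes any nonroot [z] nonzero. *)
  pose G := 'X * \prod_k \prod_j (pc_elt args p X (rshift N k)).2 j.
  have /closed_nonrootP[z] : G != 0.
    rewrite mulf_neq0 ?polyX_eq0//; apply/prodf_neq0 => k _.
    by apply/prodf_neq0 => j _; apply: pc_elt_neq0.
  rewrite rootE hornerM hornerX horner_prod mulf_eq0 negb_or.
  case/andP=> z0 /prodf_neq0 Gz.
  (* Here [j.+1] is [digit (lift ord_max j)]; the last coordinate, of digit 0, is the 1 supplied by
     [hom_pt]. *)
  exists (fun i j => z ^+ (j.+1 * d.+1 ^ i)); split=> [i j|k j].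
    exact: expf_neq0.
  have := Gz k isT; rewrite horner_prod => /prodf_neq0/(_ j isT).
  rewrite -horner_evalE -pc_elt_rmorph//; congr (_ != _).
  rewrite /pc; congr ((pc_elt _ _ _ _).2 _); apply: funext => i; apply: funext => c.
  rewrite /= horner_evalE hornerXn /hom_pt /digit.
  by case: unlift.
have hom_neq0 i j : hom_pt (x i) j != 0.
  by rewrite /hom_pt; case: unlift => [j'|]; [case: Ux | apply: oner_neq0].
(* The lift is monomial; its exponent is [- p i j] because [trop_s] is minus the order. *)
pose P i j : series R := fun e => if e == - p i j then hom_pt (x i) j else 0.
have leadP i j : lead (P i j) (- p i j) (hom_pt (x i) j) := lead_monomial _ _.
have P_neq0 i j := lead_neq0 (leadP i j) (hom_neq0 i j).
have pP i : proj_pt_K (P i).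
  by split=> [j|]; [apply: puiseux_monomial | exists ord0].
have Pp i : trop_eq (P i) (p i).
  split=> //; exists 0 => j.
  by rewrite /trop_s (lead_ord (leadP i j) (hom_neq0 i j)) opprK addr0.
have Px i : Pc_eq (P i) (hom_pt (x i)).
  exists 1; first exact: oner_neq0.
  by move=> j; rewrite mul1r (lead_Pc (leadP i j) (hom_neq0 i j)).
exists P; split => // k; exists ord0.
by case: (tropU P pP Pp (ex_intro2 _ _ x Ux Px) k).
Qed.
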